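(* Let $N\ge 3$ be an integer, let $\sigma_s\ge 0$ and $\sigma_a\ge 0$ be the scattering and absorption coefficients, and let $\mathcal{N}_i:\mathbb{R}^{N+1}\to\mathbb{R}$, $i=N-3,N-2,N-1,N$, be smooth functions of $U=(m_0,\dots,m_N)^T$. Consider the moment closure system $U_t+A(U)U_x=Q(U)$ obtained from the first $N+1$ Legendre moment equations of the radiative transfer equation with the closure relation $$\partial_x m_{N+1}=\sum_{i=N-3}^{N}\mathcal{N}_i(m_0,\dots,m_N)\,\partial_x m_i$$ (written out in the context). If for every $U\in\mathbb{R}^{N+1}$ the constraint $(\ast)$ of the context is satisfied by the coefficients $a_{N-3}(U),\dots,a_N(U)$, then the system satisfies the structural stability condition (i)–(iii) of the context.
   Context: **The system.** The unknown is $U=(m_0,\dots,m_N)^T$, a function of $(x,t)$ with values in the state space $\mathcal{G}=\mathbb{R}^{N+1}$. The moment equations are $$\partial_t m_0+\partial_x m_1=-\sigma_a m_0,$$ $$\partial_t m_k+\frac{k}{2k+1}\partial_x m_{k-1}+\frac{k+1}{2k+1}\partial_x m_{k+1}=-(\sigma_s+\sigma_a)m_k,\quad 1\le k\le N,$$ where in the equation for $k=N$ the term $\partial_x m_{N+1}$ is replaced using the closure relation. Thus, indexing rows and columns by $0,\dots,N$, the matrix $A(U)\in\mathbb{R}^{(N+1)\times(N+1)}$ has entries $A_{i,i+1}=\frac{i+1}{2i+1}$ ($0\le i\le N-1$), $A_{i,i-1}=\frac{i}{2i+1}$ ($1\le i\le N-1$), $A_{N,j}=a_j(U)$ ($N-3\le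 j\le N$), and all other entries $0$, where $a_j=\frac{N+1}{2N+1}\mathcal{N}_j$ for $j\in\{N-3,N-2,N\}$ and $a_{N-1}=\frac{N}{2N+1}+\frac{N+1}{2N+1}\mathcal{N}_{N-1}$. The source is $Q(U)=\big(-\sigma_a m_0,\,-(\sigma_s+\sigma_a)m_1,\dots,-(\sigma_s+\sigma_a)m_N\big)^T$. The coefficients $\sigma_s,\sigma_a$ may depend on $x$; the stability condition is a condition on $A(U)$ and $Q(U)$ at each fixed $x$, so $\sigma_s,\sigma_a$ are treated as nonnegative constants. **Constraint $(\ast)$.** $$a_{N-3}>-\frac{(N-1)(N-2)}{N(2N-3)},\qquad a_{N-1}>\frac{g}{(N-2)\big(a_{N-3}(2N-3)N+(N-1)(N-2)\big)^2},$$ where $$\begin{aligned} g={}&a_{N-3}^3(N-1)N^2(3-2N)^2+a_{N-2}(2N-1)(N-2)^3\big(a_{N-2}N-a_N(N-1)\big)\\&+a_{N-3}(N-2)^2\Big(a_N(4N^2-8N+3)\big(a_{N-2}N-a_N(N-1)\big)+(N-1)^3\Big)\\&+2a_{N-3}^2(N-1)^2N(2N-3)(N-2).\end{aligned}$$ **Structural stability condition.** For a system $U_t+A(U)U_x=Q(U)$ with $n$ unknowns ($n=N+1$ here), state space $\mathcal{G}\subset\mathbb{R}^n$ open, $A,Q$ smooth, let $Q_U=\partial Q/\partial U$ and let $\mathcal{E}=\{U\in\mathcal{G}: Q(U)=0\}$ be the equilibrium manifold. The condition requires that for some integer $r$ with $0\le r\le n$ (zero-size blocks are allowed): (i) there exist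 an invertible $n\times n$ matrix $P(U)$ and an invertible $r\times r$ matrix $S(U)$, defined for $U\in\mathcal{E}$, such that $P(U)Q_U(U)=\begin{pmatrix}0&0\\0&S(U)\end{pmatrix}P(U)$ for all $U\in\mathcal{E}$; (ii) there is a symmetric positive definite matrix $A_0(U)$ such that $A_0(U)A(U)=A(U)^TA_0(U)$ for all $U\in\mathcal{G}$; (iii) with these $A_0$ and $P$, $A_0(U)Q_U(U)+Q_U(U)^TA_0(U)\le -P(U)^T\begin{pmatrix}0&0\\0&I_r\end{pmatrix}P(U)$ for all $U\in\mathcal{E}$, where $I_r$ is the $r\times r$ identity matrix and $\le$ is the order of symmetric matrices ($X\le Y$ iff $Y-X$ is positive semidefinite). *)

(* Defs.v *)
From HB Require Import structures.
From mathcomp Require Import all_boot all_order all_algebra.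
From mathcomp Require Import all_classical all_reals all_analysis.

Set Implicit Arguments.
Unset Strict Implicit.
Unset Printing Implicit Defensive.

Import Order.TTheory GRing.Theory Num.Theory.
Import numFieldNormedType.Exports.

Local Open Scope classical_set_scope.
Local Open Scope ring_scope.

(* Points of R^n are row vectors, which is what the library's 'J expects. *)

Definition partial (R : realType) (n : nat) (i : 'I_n)
    (f : 'rV[R]_n -> R) : 'rV[R]_n -> R :=
  fun U => 'D_(delta_mx 0 i) f U.

(* C^oo: partial derivatives of every order exist and are continuous. *)
Definition smooth (R : realType) (n : nat) (f : 'rV[R]_n -> R) : Prop :=
  forall s : seq 'I_n, let g := foldr (@partial R n) f s in
    continuous g /\
    forall (i : 'I_n) (U : 'rV[R]_n), derivable g U (delta_mx 0 i).

Definition symmetric_mx (R : realType) (n : nat) (M : 'M[R]_n) : Prop :=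
  M^T = M.

Definition pos_def (R : realType) (n : nat) (M : 'M[R]_n) : Prop :=
  forall x : 'cV[R]_n, x != 0 -> 0 < (x^T *m M *m x) 0 0.

Definition pos_semidef (R : realType) (n : nat) (M : 'M[R]_n) : Prop :=
  forall x : 'cV[R]_n, 0 <= (x^T *m M *m x) 0 0.

Definition symmx_le (R : realType) (n : nat) (X Y : 'M[R]_n) : Prop :=
  [/\ symmetric_mx X, symmetric_mx Y & pos_semidef (Y - X)].

(* The n x n matrix (0 0; 0 S) with S of size r <= n; either block may have
   size 0. *)
Definition lower_right_block (R : realType) (n r : nat) (hr : (r <= n)%N)
    (S : 'M[R]_r) : 'M[R]_n :=
  castmx (subnK hr, subnK hr)
    (block_mx (0 : 'M[R]_(n - r)) (0 : 'M[R]_(n - r, r))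
              (0 : 'M[R]_(r, n - r)) S).

(* The library's 'J acts on row vectors, so its (i, j) entry is
   d Q_j / d U_i; the usual Jacobian matrix d Q / d U is its transpose. *)
Definition source_jacobian (R : realType) (n : nat)
    (Q : 'rV[R]_n -> 'rV[R]_n) (U : 'rV[R]_n) : 'M[R]_n :=
  ('J Q U)^T.

Definition equilibrium (R : realType) (n : nat) (G : set 'rV[R]_n)
    (Q : 'rV[R]_n -> 'rV[R]_n) : set 'rV[R]_n :=
  [set U | G U /\ Q U = 0].

(* The structural stability condition of U_t + A(U) U_x = Q(U) on the state
   space G, which is meant for G open and A, Q smooth.  The size r does not
   depend on U, while P, S and A0 do, and no regularity in U is asked of
   them. *)
Definition structural_stability (R : realType) (n : nat) (G : set 'rV[R]_n)
    (A : 'rV[R]_n -> 'M[R]_n) (Q : 'rV[R]_n -> 'rV[R]_n) : Prop :=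
  exists (r : nat) (hr : (r <= n)%N)
         (P : 'rV[R]_n -> 'M[R]_n) (S : 'rV[R]_n -> 'M[R]_r)
         (A0 : 'rV[R]_n -> 'M[R]_n),
  [/\ forall U, equilibrium G Q U ->
        [/\ P U \in unitmx, S U \in unitmx &
            P U *m source_jacobian Q U =
              lower_right_block hr (S U) *m P U],
      forall U, G U ->
        [/\ symmetric_mx (A0 U), pos_def (A0 U) &
            A0 U *m A U = (A U)^T *m A0 U] &
      forall U, equilibrium G Q U ->
        symmx_le
          (A0 U *m source_jacobian Q U + (source_jacobian Q U)^T *m A0 U)
          (- ((P U)^T *m lower_right_block hr (1%:M : 'M[R]_r) *m P U))].

(* The functions cN j give the closure
   d_x m_(N+1) = \sum_(N-3 <= j <= N) cN j (m_0, ..., m_N) d_x m_j;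
   cN j is never used for other j. *)
Definition closure_coef (R : realType) (N : nat)
    (cN : nat -> 'rV[R]_N.+1 -> R) (j : nat) (U : 'rV[R]_N.+1) : R :=
  (if j == (N - 1)%N then N%:R / (2 * N%:R + 1) else 0)
  + (N%:R + 1) / (2 * N%:R + 1) * cN j U.

Definition moment_matrix (R : realType) (N : nat)
    (cN : nat -> 'rV[R]_N.+1 -> R) (U : 'rV[R]_N.+1) : 'M[R]_N.+1 :=
  \matrix_(i < N.+1, j < N.+1)
    if i == N :> nat then
      if (N - 3 <= j)%N then closure_coef cN j U else 0
    else if j == i.+1 :> nat then (i%:R + 1) / (2 * i%:R + 1)
    else if j.+1 == i :> nat then i%:R / (2 * i%:R + 1)
    else 0.

Definition moment_source (R : realType) (N : nat) (sigma_s sigma_a : R)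
    (U : 'rV[R]_N.+1) : 'rV[R]_N.+1 :=
  \row_(k < N.+1)
    if k == 0%N :> nat then - sigma_a * U 0 k
    else - (sigma_s + sigma_a) * U 0 k.

(* a3, a2, a1, a0 stand for a_(N-3), a_(N-2), a_(N-1), a_N, and n for N as a
   real number, so that the differences below are not truncated. *)
Definition constraint_g (R : realType) (n a3 a2 a0 : R) : R :=
  a3 ^+ 3 * (n - 1) * n ^+ 2 * (3 - 2 * n) ^+ 2
  + a2 * (2 * n - 1) * (n - 2) ^+ 3 * (a2 * n - a0 * (n - 1))
  + a3 * (n - 2) ^+ 2 *
      (a0 * (4 * n ^+ 2 - 8 * n + 3) * (a2 * n - a0 * (n - 1))
       + (n - 1) ^+ 3)
  + 2 * a3 ^+ 2 * (n - 1) ^+ 2 * n * (2 * n - 3) * (n - 2).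

Definition constraint (R : realType) (n a3 a2 a1 a0 : R) : Prop :=
  - ((n - 1) * (n - 2) / (n * (2 * n - 3))) < a3 /\
  constraint_g n a3 a2 a0
    / ((n - 2) * (a3 * (2 * n - 3) * n + (n - 1) * (n - 2)) ^+ 2) < a1.

(* Main.v *)
(* In the coordinates m_0, ..., m_N the matrix A(U) has a symmetrizer that is a
   rank-one correction of a diagonal one, A1 = D + t v^T v with
   v = (0, ..., 0, p, tau, 1) and D = diag(1, 3, ..., 2N-3, w, 0): the Legendre
   recurrence is symmetrized by diag(2i+1), and the closure only disturbs the
   last 3 x 3 block.  Symmetry of A1 A(U) determines p, tau, w and t, and the
   two inequalities of the constraint amount to w > 0 and t > 0.  Completing the
   square gives A1 = P^T P with P invertible and lower triangular.  As N >= 3,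
   v_0 = 0, so P does not mix m_0 with the other moments and commutes with
   Q_U = - diag(sigma_a, sigma_s + sigma_a, ..., sigma_s + sigma_a).  Then
   A0 = kappa P^T P with a large constant kappa satisfies (iii), the two sides
   being P^T F P with F diagonal. *)
Require Import Defs.
From mathcomp Require Import all_boot all_order all_algebra.
From mathcomp Require Import all_classical all_reals all_analysis.
From mathcomp Require Import zify ring lra.

Set Implicit Arguments.
Unset Strict Implicit.
Unset Printing Implicit Defensive.

Import Order.TTheory GRing.Theory Num.Theory.
Import numFieldNormedType.Exports.

Local Open Scope classical_set_scope.
Local Open Scope ring_scope.

(** * Jacobian of the source and diagonal blocks *)

Lemma jacobian_mulmxr (R : realType) (m n : nat) (M : 'M[R]_(m.+1, n.+1))
    (U : 'rV[R]_m.+1) : 'J (mulmxr M) U = M.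
Proof.
have dM V : differentiable (mulmxr M : 'rV[R]_m.+1 -> 'rV[R]_n.+1) V.
  (* A sum of coordinates times fixed rows is differentiable, hence continuous; a continuous linear
     map is its own differential. *)
  have -> : (mulmxr M : 'rV[R]_m.+1 -> 'rV[R]_n.+1) =
      \sum_(i < m.+1) (fun W : 'rV[R]_m.+1 => W 0 i *: row i M).
    by apply/funext => W; rewrite fct_sumE /= mulmx_sum_row.
  apply: differentiable_sum => i.
  exact/differentiableZl/differentiable_coord.
have cM : continuous (mulmxr M : 'rV[R]_m.+1 -> 'rV[R]_n.+1).
  by move=> V; exact: differentiable_continuous.
apply/row_matrixP => i; rewrite rowE mul_rV_lin1 diff_lin //= -rowE //.
Qed.

Lemma source_jacobian_moment (R : realType) (N : nat) (sigma_s sigma_a : R)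
    (U : 'rV[R]_N.+1) :
  source_jacobian (moment_source sigma_s sigma_a) U =
  diag_mx (\row_(k < N.+1) (if k == 0 then - sigma_a else - (sigma_s + sigma_a))).
Proof.
set q := \row_k _.
have -> : moment_source sigma_s sigma_a = mulmxr (diag_mx q).
  apply/funext => V; apply/rowP => k; rewrite /= mul_mx_diag !mxE -val_eqE /=.
  by case: ifP => _; rewrite mulrC.
by rewrite /source_jacobian jacobian_mulmxr tr_diag_mx.
Qed.

(** Eliminates the cast, so that both block matrices in the stability condition can be handled as
    diagonal matrices. *)
Lemma lower_right_block_diag (R : realType) (n r : nat) (hr : (r <= n)%N)
    (q : 'rV[R]_n) (s : 'rV[R]_r) :
  (forall i : 'I_n, (i < n - r)%N -> q 0 i = 0) ->
  (forall (i : 'I_n) (k : 'I_r), i = (n - r + k)%N :> nat -> q 0 i = s 0 k) ->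
  lower_right_block hr (diag_mx s) = diag_mx q.
Proof.
move=> q0 qs; rewrite /lower_right_block -(raddf0 (@diag_mx R (n - r))) -diag_mx_row.
apply/matrixP => i j; rewrite castmxE !mxE (inj_eq (@cast_ord_inj _ _ _)).
congr (_ *+ _); case: splitP => k /= ik; rewrite ?mxE; first by rewrite q0 // ik.
exact/esym/qs.
Qed.

(** The diagonal matrix is scalar on the index 0 and on the remaining indices, and [P] preserves
    this splitting. *)
Lemma diag_mx_commute_block (R : realType) (n : nat) (c0 c : R)
    (P : 'M[R]_n.+1) :
  (forall j, j != 0 -> P 0 j = 0) -> (forall i, i != 0 -> P i 0 = 0) ->
  diag_mx (\row_k (if k == 0 then c0 else c)) *m P =
  P *m diag_mx (\row_k (if k == 0 then c0 else c)).
Proof.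
move=> P0r P0l; rewrite mul_diag_mx mul_mx_diag.
apply/matrixP => i j; rewrite !mxE.
have [->|i0] := eqVneq i 0; have [->|j0] := eqVneq j 0; first by rewrite mulrC.
- by rewrite P0r // mul0r mulr0.
- by rewrite P0l // mul0r mulr0.
- by rewrite mulrC.
Qed.

Lemma sqr_norm_gt0 (R : realType) (n : nat) (y : 'cV[R]_n) :
  y != 0 -> 0 < (y^T *m y) 0 0.
Proof.
move=> y0; rewrite mxE lt_def sumr_ge0 ?andbT; last first.
  by move=> i _; rewrite mxE -expr2 sqr_ge0.
apply: contra y0 => /eqP; under eq_bigr do rewrite mxE -expr2.
move=> /psumr_eq0P sy; apply/eqP/colP => i; rewrite [RHS]mxE.
by apply/eqP; rewrite -sqrf_eq0 sy // => j _; rewrite sqr_ge0.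
Qed.

(** * Parameters of the rank-one correction *)

(* The four equations say that (D + t v^T v) A(U) is symmetric.  With
   H = a3 (2n-3) n + (n-1)(n-2), the first part of the constraint is 0 < H, and
   then the second one is 0 < delta. *)
Lemma symmetrizer_parameters (R : realType) (n a3 a2 a1 a0 : R) :
  3 <= n -> constraint n a3 a2 a1 a0 ->
  let d := (n - 2 + 1) / (2 * (n - 2) + 1) in
  let e := (n - 1) / (2 * (n - 1) + 1) in
  let f := (n - 1 + 1) / (2 * (n - 1) + 1) in
  exists p tau w t : R,
  [/\ 0 < w /\ 0 < t,
      p * ((n - 2) / (2 * (n - 2) + 1)) + a3 = 0,
      p * (tau * f + a0) = tau * e + a2,
      w * f + t * tau * (tau * f + a0) = t * (p * d + a1) &
      n - 1 + t * p * (p * d + a1) = w * e + t * tau * (tau * e + a2)].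
Proof.
move=> n3 [ca3 ca1] d e f.
have n0 : 0 < n by lra.
have n1 : 0 < n - 1 by lra.
have n2 : 0 < n - 2 by lra.
have d1 : 0 < 2 * n - 1 by lra.
have d2 : 0 < 2 * n - 3 by lra.
have [n0' n2' d1' d2'] : [/\ n != 0, n - 2 != 0, 2 * n - 1 != 0 & 2 * n - 3 != 0].
  by rewrite !gt_eqF.
have -> : d = (n - 1) / (2 * n - 3).
  by rewrite /d; congr (_ / _); ring.
have -> : e = (n - 1) / (2 * n - 1).
  by rewrite /e; congr (_ / _); ring.
have -> : f = n / (2 * n - 1).
  by rewrite /f; congr (_ / _); ring.
have -> : (n - 2) / (2 * (n - 2) + 1) = (n - 2) / (2 * n - 3).
  by congr (_ / _); ring.
set H := a3 * (2 * n - 3) * n + (n - 1) * (n - 2).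
have H0 : 0 < H.
  move: ca3; rewrite -subr_gt0 opprK => ca3.
  have -> : H = (a3 + (n - 1) * (n - 2) / (n * (2 * n - 3))) * (n * (2 * n - 3)).
    by rewrite /H; field; rewrite n0' d2'.
  by rewrite mulr_gt0 // mulr_gt0.
have H0' : H != 0 by rewrite gt_eqF.
(* [p] solves the first equation, then [tau] the second, which is linear in [tau] with leading
   coefficient a nonzero multiple of [H]. The second and third turn the fourth into
   [n - 1 + p * w * f = w * e], which gives [w]; the third reads [w * f = t * delta], which gives
   [t]. *)
pose p := - (a3 * (2 * n - 3) / (n - 2)).
pose tau := - ((a2 * (n - 2) + a3 * a0 * (2 * n - 3)) * (2 * n - 1) / H).
pose w := (n - 1) * (n - 2) * (2 * n - 1) / H.
pose delta := p * ((n - 1) / (2 * n - 3)) + a1 - tau * a0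
  - n / (2 * n - 1) * tau ^+ 2.
have w0 : 0 < w by rewrite divr_gt0 // !mulr_gt0.
have delta0 : 0 < delta.
  move: ca1; rewrite -subr_gt0; congr (0 < _).
  pose K := a2 * (n - 2) + a3 * a0 * (2 * n - 3).
  (* Once [g] is written as a quadratic form in [H] and [K], the margin in the second inequality is
     seen to be exactly [delta]. *)
  have -> : constraint_g n a3 a2 a0 = a3 * (n - 1) * H ^+ 2
      - a0 * (n - 2) * (2 * n - 1) * K * H + n * (2 * n - 1) * (n - 2) * K ^+ 2.
    by rewrite /constraint_g /H /K; ring.
  by rewrite /delta /p /tau -/K -/H; field; rewrite d1' d2' H0' n2'.
pose t := w * (n / (2 * n - 1)) / delta.
have t0 : 0 < t by rewrite !(divr_gt0, mulr_gt0).
have td : t * delta = w * (n / (2 * n - 1)) by rewrite divfK ?gt_eqF.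
have pE : p * ((n - 2) / (2 * n - 3)) + a3 = 0.
  by rewrite /p; field; rewrite d2' n2'.
have tauE : p * (tau * (n / (2 * n - 1)) + a0) = tau * ((n - 1) / (2 * n - 1)) + a2.
  by rewrite /p /tau /H; field; rewrite -/H d1' H0' n2'.
have wE : w * ((n - 1) / (2 * n - 1)) = n - 1 + p * (w * (n / (2 * n - 1))).
  by rewrite /w /p /H; field; rewrite -/H d1' H0' n2'.
by exists p, tau, w, t; split => //; rewrite -?tauE ?wE -td /delta; ring.
Qed.

(** * Symmetry of the corrected matrix, entry by entry *)

(** [moment_matrix] with natural number indices, which spares ordinals in the case analysis; [b]
    stands for the closure coefficients at a fixed state. *)
Definition moment_entry (R : realType) (N : nat) (b : nat -> R) (i j : nat) : R :=
  if i == N then if (N - 3 <= j)%N then b j else 0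
  else if j == i.+1 then (i%:R + 1) / (2 * i%:R + 1)
  else if j.+1 == i then i%:R / (2 * i%:R + 1)
  else 0.

(** For [j = i + 1] both sides equal [i + 1]; otherwise both entries vanish. *)
Lemma moment_entry_interior_sym (R : realType) (N : nat) (b : nat -> R)
    (i j : nat) : (i < j < N)%N ->
  (2 * i%:R + 1) * moment_entry N b i j = (2 * j%:R + 1) * moment_entry N b j i.
Proof.
move=> /andP[ij jN]; rewrite /moment_entry (ltn_eqF jN) (ltn_eqF (ltn_trans ij jN)).
have [-> /=|ji] := eqVneq j i.+1.
  case: eqP => [|_]; first lia.
  by rewrite -natr1; have : (0 : R) <= i%:R by []; move=> i0; field; lra.
by do 2 (case: eqP => [|_]; first lia); rewrite !mulr0.
Qed.

Definition corner_vector (R : realType) (N : nat) (p tau : R) (i : nat) : R :=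
  if i == N then 1 else if i.+1 == N then tau else if i.+2 == N then p else 0.

(** The last weight is 0 because the square of the last coordinate comes from the rank-one term
    alone. *)
Definition diagonal_weight (R : realType) (N : nat) (w : R) (i : nat) : R :=
  if i == N then 0 else if i.+1 == N then w else 2 * i%:R + 1.

Definition corner_row (R : realType) (N : nat) (b : nat -> R) (p tau : R)
    (j : nat) : R :=
  p * moment_entry N b (N - 2) j + tau * moment_entry N b (N - 1) j
  + moment_entry N b N j.

(* The two sides are the (i, j) and (j, i) entries of (D + t v^T v) A(U), where
   v = corner_vector, D = diag(diagonal_weight) and corner_row is v A(U). *)
Lemma symmetrized_entry_sym (R : realType) (N : nat) (hN : (3 <= N)%N)
    (b : nat -> R)
    (hb : constraint N%:R (b (N - 3)%N) (b (N - 2)%N) (b (N - 1)%N) (b N)) :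
  exists p tau w t : R, [/\ 0 < w, 0 < t & forall i j : nat,
    (i <= N)%N -> (j <= N)%N ->
    diagonal_weight N w i * moment_entry N b i j
      + t * corner_vector N p tau i * corner_row N b p tau j =
    diagonal_weight N w j * moment_entry N b j i
      + t * corner_vector N p tau j * corner_row N b p tau i].
Proof.
(* With [N = m + 3] the truncated subtractions disappear, and the corner consists of the indices
   [m + 1], [m + 2], [m + 3]. *)
case: N hN hb => [|[|[|m]]] // _; rewrite !subSS !subn0 => hb.
have n3 : (3 : R) <= m.+3%:R by rewrite ler_nat.
have [p [tau [w [t [[w0 t0]]]]]] := symmetrizer_parameters n3 hb.
have -> : m.+3%:R - 2 = m.+1%:R :> R by rewrite -!natr1; ring.
have -> : m.+3%:R - 1 = m.+2%:R :> R by rewrite -!natr1; ring.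
move=> eqp eqtau eqw eqd.
exists p, tau, w, t; split=> //.
set v := corner_vector _ p tau; set u := corner_row _ b p tau.
set D := diagonal_weight _ w; set a := moment_entry _ b.
have v0 i : (i <= m)%N -> v i = 0.
  by move=> im; rewrite /v /corner_vector; do 3 (case: eqP => [|_]; first lia).
have v1 : v m.+1 = p.
  by rewrite /v /corner_vector eqxx; do 2 (case: eqP => [|_]; first lia).
have v2 : v m.+2 = tau.
  by rewrite /v /corner_vector eqxx; case: eqP => [|_]; first lia.
have v3 : v m.+3 = 1 by rewrite /v /corner_vector eqxx.
have D0 i : (i <= m.+1)%N -> D i = 2 * i%:R + 1.
  by move=> im; rewrite /D /diagonal_weight; do 2 (case: eqP => [|_]; first lia).
have D2 : D m.+2 = w.
  by rewrite /D /diagonal_weight eqxx; case: eqP => [|_]; first lia.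
have D3 : D m.+3 = 0 by rewrite /D /diagonal_weight eqxx.
have a0 i j : (i < m.+3)%N -> (j != i.+1) -> (i != j.+1) -> a i j = 0.
  move=> im ji ij; rewrite /a /moment_entry ltn_eqF // (negPf ji) eq_sym.
  by rewrite (negPf ij).
have aup i : (i < m.+3)%N -> a i i.+1 = (i%:R + 1) / (2 * i%:R + 1).
  by move=> im; rewrite /a /moment_entry ltn_eqF // eqxx.
have adown i : (i.+1 < m.+3)%N -> a i.+1 i = i.+1%:R / (2 * i.+1%:R + 1).
  move=> im; rewrite /a /moment_entry ltn_eqF // eqxx.
  by case: eqP => [|_]; first lia.
have alast j : (m <= j)%N -> a m.+3 j = b j.
  by move=> mj; rewrite /a /moment_entry eqxx !subSS subn0 mj.
have alast0 j : (j < m)%N -> a m.+3 j = 0.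
  by move=> mj; rewrite /a /moment_entry eqxx !subSS subn0 leqNgt mj.
have uE j : u j = p * a m.+1 j + tau * a m.+2 j + a m.+3 j.
  by rewrite /u /corner_row !subSS !subn0.
(* For [j = m] this is the equation defining [p]: it keeps the rank-one term inside the corner. *)
have u0 j : (j <= m)%N -> u j = 0.
  rewrite leq_eqVlt uE => /predU1P[->|jm].
    by rewrite adown ?(a0 m.+2) ?alast //; [lra|lia|lia].
  by rewrite (a0 m.+1) ?(a0 m.+2) ?alast0; [lra|lia..].
have u1 : u m.+1 = tau * (m.+2%:R / (2 * m.+2%:R + 1)) + b m.+1.
  by rewrite uE (a0 m.+1) ?adown ?alast; [lra|lia..].
have u2 : u m.+2 = p * ((m.+1%:R + 1) / (2 * m.+1%:R + 1)) + b m.+2.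
  by rewrite uE (a0 m.+2) ?aup ?alast; [lra|lia..].
have u3 : u m.+3 = tau * ((m.+2%:R + 1) / (2 * m.+2%:R + 1)) + b m.+3.
  by rewrite uE (a0 m.+1) ?aup ?alast; [lra|lia..].
have m1 : (0 : R) <= m.+1%:R by [].
have main i j : (i < j)%N -> (j <= m.+3)%N ->
    D i * a i j + t * v i * u j = D j * a j i + t * v j * u i.
  move=> ij jm; have [im|mi] := leqP i m.
    (* No rank-one contribution here: either the interior symmetry applies, or both sides vanish,
       for [j = m + 3] because the last weight is 0. *)
    rewrite (v0 i) // (u0 i) // !mulr0 mul0r !addr0.
    have [jm1|m1j] := leqP j m.+1.
      rewrite !D0; [|lia..]; apply: moment_entry_interior_sym; lia.
    rewrite (a0 i j); [|lia..]; rewrite mulr0.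
    move: jm; rewrite leq_eqVlt => /predU1P[->|jm]; first by rewrite D3 mul0r.
    by rewrite (a0 j i) ?mulr0 //; lia.
  (* The three remaining pairs use the fourth, second and third equations of
     [symmetrizer_parameters], in this order. *)
  have [[-> ->]|[[-> ->]|[-> ->]]] :
      (i = m.+1 /\ j = m.+2) \/ (i = m.+1 /\ j = m.+3) \/ (i = m.+2 /\ j = m.+3)
    by lia.
  - rewrite v1 v2 u1 u2 aup ?adown ?D2 ?D0; [|lia..].
    rewrite -eqd; congr (_ + _).
    by rewrite -[m.+2]addn1 natrD; field; lra.
  - by rewrite v1 v3 u1 u3 (a0 m.+1) ?D3; [|lia..]; rewrite -eqtau; ring.
  - by rewrite v2 v3 u2 u3 aup ?D2 ?D3 // eqw; ring.
move=> i j im jm; case: (ltngtP i j) => [ij|ji|->] //; first exact: main.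
exact/esym/main.
Qed.

(** * Factorization of the symmetrizer *)

Lemma sum_corner_vector (R : realType) (N : nat) (hN : (3 <= N)%N)
    (b : nat -> R) (p tau : R) (j : nat) :
  \sum_(k < N.+1) corner_vector N p tau k * moment_entry N b k j =
  corner_row N b p tau j.
Proof.
case: N hN => [|[|[|m]]] // _; rewrite /corner_row !subSS !subn0.
rewrite !big_ord_recr /= big1 ?add0r => [|k _]; last first.
  rewrite /corner_vector; have km := ltn_ord k.
  by do 3 (case: eqP => [|_]; first lia); rewrite mul0r.
rewrite /corner_vector !eqxx mul1r.
by do ?(case: eqP => [|_]; first lia); rewrite mul0r add0r.
Qed.

(** The zeros in the first row and column let the same [P] serve for the block form of the Jacobian
    of the source. *)
Lemma moment_symmetrizer (R : realType) (N : nat) (hN : (3 <= N)%N)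
    (cN : nat -> 'rV[R]_N.+1 -> R) (U : 'rV[R]_N.+1) :
  constraint N%:R
    (closure_coef cN (N - 3) U) (closure_coef cN (N - 2) U)
    (closure_coef cN (N - 1) U) (closure_coef cN N U) ->
  exists P : 'M[R]_N.+1, [/\ P \in unitmx,
    forall j, j != 0 -> P 0 j = 0, forall i, i != 0 -> P i 0 = 0 &
    P^T *m P *m moment_matrix cN U = (moment_matrix cN U)^T *m (P^T *m P)].
Proof.
set b := (fun j : nat => closure_coef cN j U).
move=> /(@symmetrized_entry_sym _ _ hN b) [p [tau [w [t [w0 t0 symE]]]]].
pose v := corner_vector N p tau; pose D := diagonal_weight N w.
have vN : v N = 1 by rewrite /v /corner_vector eqxx.
have v0 : v 0%N = 0.
  by rewrite /v /corner_vector; do 3 (case: eqP => [|_]; first lia).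
have DN : D N = 0 by rewrite /D /diagonal_weight eqxx.
have Dgt0 i : i != N -> 0 < D i.
  rewrite /D /diagonal_weight => /negPf ->; case: (i.+1 == N) => //=.
(* The rows are [sqrt (D i)] times unit vectors for [i < N], then [sqrt t] times [v]; since
   [D N = 0], their squares make up all of [D + t v^T v]. *)
pose P : 'M[R]_N.+1 := \matrix_(i, j)
  (if i == N :> nat then Num.sqrt t * v j else Num.sqrt (D i) *+ (i == j)).
have PP : P^T *m P = diag_mx (\row_k D k) + t *: ((\row_k v k)^T *m (\row_k v k)).
  apply/matrixP => i j; rewrite !mxE big_ord1 !mxE.
  rewrite (eq_bigr (fun k : 'I_N.+1 =>
    D k *+ (k == i) *+ (k == j) + (t * (v i * v j)) *+ (k == ord_max))).
    rewrite big_split /= (bigD1 i) //= big1 ?addr0 => [|k /negPf ->]; last first.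
      by rewrite mulr0n mul0rn.
    rewrite eqxx mulr1n; congr (_ + _).
    rewrite (bigD1 ord_max) //= eqxx big1 ?addr0 // => k /negPf ->.
    by rewrite mulr0n.
  move=> k _; rewrite !mxE -(inj_eq val_inj k ord_max) /=.
  have [->|kN] := eqVneq (k : nat) N.
    rewrite DN !mul0rn add0r mulr1n -[in RHS](sqr_sqrtr (ltW t0)); ring.
  rewrite mulr0n addr0 -[in RHS](sqr_sqrtr (ltW (Dgt0 _ kN))) expr2.
  by do 2 case: (_ == _); rewrite /= ?mulr1n ?mulr0n ?mul0r ?mulr0.
have PA : P^T *m P *m moment_matrix cN U = \matrix_(i, j)
    (D i * moment_entry N b i j + t * v i * corner_row N b p tau j).
  rewrite PP mulmxDl mul_diag_mx -scalemxAl -mulmxA.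
  apply/matrixP => i j; rewrite !mxE big_ord1 !mxE; congr (_ + _).
  rewrite -mulrA -(sum_corner_vector hN); congr (_ * (_ * _)).
  by apply: eq_bigr => k _; rewrite !mxE.
exists P; split.
- have Ptrig : is_trig_mx P.
    apply/is_trig_mxP => i j ij; rewrite mxE.
    case: eqP => [iN|_]; first by have := ltn_ord j; lia.
    by rewrite -val_eqE ltn_eqF.
  rewrite unitmxE det_trig // unitfE; apply/prodf_neq0 => i _.
  rewrite mxE; have [->|iN] := eqVneq (i : nat) N; first by rewrite vN mulr1 gt_eqF ?sqrtr_gt0.
  by rewrite eqxx gt_eqF ?sqrtr_gt0 ?Dgt0.
- move=> j j0; rewrite mxE /=; case: eqP => [|_]; first lia.
  by rewrite eq_sym (negPf j0).
- by move=> i i0; rewrite mxE /= v0 mulr0 (negPf i0); case: ifP.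
- have -> : (moment_matrix cN U)^T *m (P^T *m P) = (P^T *m P *m moment_matrix cN U)^T.
    by rewrite !trmx_mul trmxK.
  rewrite PA; apply/matrixP => i j; rewrite !mxE.
  by apply: symE; rewrite -ltnS.
Qed.

(** * Verification of the stability condition *)

(* r = 0 if both entries vanish, r = N if only c0 does, and r = N + 1 otherwise. *)
Lemma diag_split (R : realType) (N : nat) (c0 c : R) : (c = 0 -> c0 = 0) ->
  let q := \row_(k < N.+1) (if k == 0 then c0 else c) in
  exists r (hr : (r <= N.+1)%N) (S : 'M[R]_r), [/\ S \in unitmx,
    diag_mx q = lower_right_block hr S &
    lower_right_block hr (1%:M : 'M[R]_r) = diag_mx (\row_k (q 0 k != 0)%:R)].
Proof.
move=> cc0 q.
have unit_diag r (s : 'rV[R]_r) : (forall k, s 0 k != 0) -> diag_mx s \in unitmx.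
  by move=> s0; rewrite unitmxE det_diag unitfE; apply/prodf_neq0 => k _.
have [c_0|c_0] := eqVneq c 0.
  exists 0%N, (leq0n _), (diag_mx 0); split.
  - by rewrite unit_diag // => -[].
  - apply/esym/lower_right_block_diag => [i _|i []//].
    by rewrite mxE c_0 cc0 // if_same.
  - rewrite -diag_const_mx; apply/lower_right_block_diag => [i _|i []//].
    by rewrite !mxE c_0 cc0 // if_same eqxx.
have [c0_0|c0_0] := eqVneq c0 0; last first.
  exists N.+1, (leqnn _), (diag_mx q); split.
  - by apply: unit_diag => k; rewrite mxE; case: ifP.
  - apply/esym/lower_right_block_diag => [i|i k]; first by rewrite subnn.
    by rewrite subnn add0n => /val_inj ->.
  - rewrite -diag_const_mx; apply/lower_right_block_diag => [i|i k].
      by rewrite subnn.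
    by rewrite !mxE => _; case: ifP; rewrite ?c_0 ?c0_0.
exists N, (leqnSn _), (diag_mx (const_mx c)); split.
- by apply: unit_diag => k; rewrite mxE.
- apply/esym/lower_right_block_diag => i; rewrite subSnn.
    by rewrite mxE -val_eqE ltnS leqn0 /= => ->.
  by move=> k ik; rewrite !mxE -val_eqE /= ik.
- rewrite -diag_const_mx; apply/lower_right_block_diag => i; rewrite subSnn.
    by rewrite !mxE -val_eqE ltnS leqn0 /= => ->; rewrite c0_0 eqxx.
  by move=> k ik; rewrite !mxE -val_eqE /= ik c_0.
Qed.

Lemma quadratic_form_diag (R : realType) (n : nat) (f : 'rV[R]_n) (y : 'cV[R]_n) :
  (y^T *m diag_mx f *m y) 0 0 = \sum_i f 0 i * y i 0 ^+ 2.
Proof.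
by rewrite mul_mx_diag mxE; apply: eq_bigr => i _; rewrite !mxE; ring.
Qed.

Theorem theorem2p4 (R : realType) (N : nat) (hN : (3 <= N)%N)
    (sigma_s sigma_a : R) (hs : 0 <= sigma_s) (ha : 0 <= sigma_a)
    (cN : nat -> 'rV[R]_N.+1 -> R)
    (hsmooth : forall j : nat, (N - 3 <= j <= N)%N -> smooth (cN j))
    (hconstraint : forall U : 'rV[R]_N.+1,
       constraint N%:R
         (closure_coef cN (N - 3) U) (closure_coef cN (N - 2) U)
         (closure_coef cN (N - 1) U) (closure_coef cN N U)) :
  structural_stability [set: 'rV[R]_N.+1]
    (moment_matrix cN) (moment_source sigma_s sigma_a).
Proof.
have sym U := cid (moment_symmetrizer hN (hconstraint U)).
pose P U := sval (sym U).
have PU U : P U \in unitmx by have [] := svalP (sym U).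
have Pcomm U c0 c : diag_mx (\row_k (if k == 0 then c0 else c)) *m P U =
    P U *m diag_mx (\row_k (if k == 0 then c0 else c)).
  by apply: diag_mx_commute_block; have [] := svalP (sym U).
have PA U : (P U)^T *m P U *m moment_matrix cN U =
    (moment_matrix cN U)^T *m ((P U)^T *m P U) by have [] := svalP (sym U).
(* Nonnegativity excludes [sigma_s + sigma_a = 0 < sigma_a], so the zero entries of the Jacobian
   come first, as the block form demands. *)
have cc0 : - (sigma_s + sigma_a) = 0 -> - sigma_a = 0 by lra.
have [r [hr [S [SU qS qE]]]] := @diag_split R N _ _ cc0.
set q := \row_k _ in qS qE.
(* This gives [kappa * s >= 1] for each nonzero rate [s]; a zero rate has inverse 0, and the summand
   1 keeps [kappa] positive when both rates vanish. *)
pose kappa := 1 + sigma_a^-1 + (sigma_s + sigma_a)^-1.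
have ka : 0 <= sigma_a^-1 by rewrite invr_ge0.
have ks : 0 <= (sigma_s + sigma_a)^-1 by rewrite invr_ge0 addr_ge0.
have kappa0 : 0 < kappa by rewrite /kappa; lra.
have kappaP s : 0 <= s -> s^-1 <= kappa ->
    0 <= - ((- s != 0)%:R + 2 * kappa * - s).
  move=> s_ge0 sk; rewrite oppr_eq0; have [->|s0] := eqVneq s 0.
    by rewrite /= oppr0 mulr0 addr0 oppr0.
  have : 1 <= kappa * s by rewrite -(mulVf s0) ler_wpM2r.
  by rewrite /=; lra.
exists r, hr, P, (fun=> S), (fun U => kappa *: ((P U)^T *m P U)).
split=> [U _|U _|U _].
- by rewrite source_jacobian_moment -qS Pcomm.
- split.
  + by rewrite /symmetric_mx linearZ /= trmx_mul trmxK.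
  + move=> x x0; rewrite -scalemxAr -scalemxAl mxE mulr_gt0 //.
    rewrite !mulmxA -trmx_mul -mulmxA sqr_norm_gt0 //.
    apply: contra x0 => /eqP Px; rewrite -(mulKmx (PU U) x) Px mulmx0 //.
  + by rewrite -scalemxAl PA scalemxAr.
- rewrite source_jacobian_moment tr_diag_mx qE -/q.
  have qP : diag_mx q *m (P U)^T = (P U)^T *m diag_mx q.
    by apply: trmx_inj; rewrite !trmx_mul tr_diag_mx trmxK Pcomm.
  (* The Jacobian commutes with [P] and its transpose, so both summands are the same congruence of
     it. *)
  have XE : kappa *: ((P U)^T *m P U) *m diag_mx q
      + diag_mx q *m (kappa *: ((P U)^T *m P U)) =
      (P U)^T *m ((2 * kappa) *: diag_mx q) *m P U.
    rewrite -!scalemxAr -!scalemxAl (mulmxA (diag_mx q)) qP.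
    rewrite -[_ *m _ *m diag_mx q]mulmxA -Pcomm mulmxA -scalerDl.
    by congr (_ *: _); ring.
  have symD (d : 'rV[R]_N.+1) : symmetric_mx ((P U)^T *m diag_mx d *m P U).
    by rewrite /symmetric_mx !trmx_mul trmxK tr_diag_mx mulmxA.
  rewrite XE -linearZ /=; split; first exact: symD.
    by rewrite /symmetric_mx linearN /= symD.
  (* With [y = P x] the form of the difference is the sum of [F_k * y_k ^ 2], and [kappaP] gives
     [F_k >= 0]. *)
  move=> x; rewrite -opprD -mulmxDl -mulmxDr -linearD /= -mulNmx -mulmxN -linearN.
  rewrite !mulmxA -trmx_mul -[_ *m P U *m x]mulmxA quadratic_form_diag.
  apply: sumr_ge0 => k _; rewrite mulr_ge0 ?sqr_ge0 // !mxE.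
  by case: ifP => _; apply: kappaP; rewrite ?addr_ge0 //; rewrite /kappa; lra.
Qed.
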